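(* Fix $n\ge1$. Let $f\in L^\infty(\overline\Omega)$ and let $u_n$ be the solution of the Dirichlet problem $$ \begin{aligned} f(x) ={}& \chi_{A_n}(x)\int_{A_n} J(x,y)(u_n(y)-u_n(x))\,dy + \chi_{A_n}(x)\int_{B_n} R(x,y)(u_n(y)-u_n(x))\,dy\\ &+\chi_{B_n}(x)\int_{A_n} R(x,y)(u_n(y)-u_n(x))\,dy+\chi_{B_n}(x)\int_{B_n} G(x,y)(u_n(y)-u_n(x))\,dy,\qquad x\in\overline\Omega, \end{aligned} $$ with $u_n=0$ outside $\overline\Omega$. Assume $\inf_{x\in\overline\Omega}q_n(x)>0$, where $q_n$ is the function defined in the context. Let $s_n:=\inf\{t\ge0: Z_n(t)\notin\overline\Omega\}$ be the first time at which the process $Z_n$ jumps outside $\overline\Omega$. Then $$P^x(s_n<\infty)=1,\qquad x\in\overline\Omega,$$ and $$u_n(x)=-\mathbb{E}^x\Big[\int_0^{s_n}f(Z_n(t))\,dt\Big],\qquad x\in\overline\Omega .$$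
   Context: $\Omega\subset\mathbb{R}^N$ is a bounded domain (open, connected). The kernels $V=J,G,R$ each satisfy: $V:\mathbb{R}^N\times\mathbb{R}^N\to\mathbb{R}$ is continuous and non-negative, $V(x,x)>0$ for every $x$, $V(x,y)=V(y,x)$ for all $x,y$, and $\int_{\mathbb{R}^N}V(x,y)\,dy=1$ for every $x$. $A_n,B_n$ are measurable sets with $\mathbb{R}^N=A_n\cup B_n$ and $A_n\cap B_n=\emptyset$; $\chi_E$ is the characteristic function of $E$, and $\overline\Omega^c=\mathbb{R}^N\setminus\overline\Omega$. The functions $f$ (bounded measurable) and $u_n$ (measurable, square integrable) are everywhere-defined and the equation holds for every $x\in\overline\Omega$. $(Z_n(t))_{t\ge0}$ is the continuous-time pure jump Markov process started in $\overline\Omega$, killed (stopped) as soon as it jumps outside $\overline\Omega$, with generator acting on functions $g$ supported in $\overline\Omega$ by $$ \begin{aligned} L_n g(x)={}&\chi_{A_n\cap\overline\Omega}(x)\int_{\mathbb{R}^N}\chi_{A_n}(y)J(x,y)(g(y)-g(x))\,dy+\chi_{B_n\cap\overline\Omega}(x)\int_{\mathbb{R}^N}\chi_{B_n}(y)G(x,y)(g(y)-g(x))\,dy\\ &+\chi_{A_n\cap\overline\Omega}(x)\int_{\mathbb{R}^N}\chi_{B_n}(y)R(x,y)(g(y)-g(x))\,dy+\chi_{B_n\cap\overline\Omega}(x)\int_{\mathbb{R}^N}\chi_{A_n}(y)R(x,y)(g(y)-g(x))\,dy . \end{aligned} $$ That is, from $x\in\overline\Omega$ the process jumps to $y\in\mathbb{R}^N$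 with rate density $J(x,y)$ if $x,y\in A_n$, $G(x,y)$ if $x,y\in B_n$, and $R(x,y)$ otherwise; points outside $\overline\Omega$ are absorbing. $P^x$ is the law of the process started at $x$ and $\mathbb{E}^x$ its expectation. For $x\in\overline\Omega$, $$ \begin{aligned} q_n(x)={}&\chi_{A_n\cap\overline\Omega}(x)\Big(\int_{\overline\Omega^c}\chi_{A_n}(y)J(x,y)\,dy+\int_{\overline\Omega^c}\chi_{B_n}(y)R(x,y)\,dy\Big)\\ &+\chi_{B_n\cap\overline\Omega}(x)\Big(\int_{\overline\Omega^c}\chi_{A_n}(y)R(x,y)\,dy+\int_{\overline\Omega^c}\chi_{B_n}(y)G(x,y)\,dy\Big). \end{aligned} $$ *)

(* Defs.v *)
From HB Require Import structures.
From mathcomp Require Import all_boot all_order all_algebra.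
From mathcomp Require Import all_classical all_reals all_analysis.
From mathcomp Require Import measurable_realfun.

Set Implicit Arguments.
Unset Strict Implicit.
Unset Printing Implicit Defensive.

Import Order.TTheory GRing.Theory Num.Theory.
Import numFieldNormedType.Exports.

Local Open Scope classical_set_scope.
Local Open Scope ring_scope.

(* The Borel sigma-algebra on matrices, in particular on R^N = 'rV[R]_N. *)
HB.instance Definition _ (R : realType) (m n : nat) :=
  @isMeasurable.Build (sigma_display (@open 'M[R]_(m, n))) 'M[R]_(m, n)
    <<s @open 'M[R]_(m, n) >>
    (@sigma_algebra0 _ setT _) (@sigma_algebraC _ _)
    (@sigma_algebra_bigcup _ setT _).

Lemma measurable_mx d (T : measurableType d) (R : realType) (m n : nat)
    (f : T -> 'M[R]_(m, n)) :
  (forall i j, measurable_fun setT (fun t => f t i j)) -> measurable_fun setT f.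
Proof.
move=> mf; apply: (@measurability _ _ _ _ _ _ (@open 'M[R]_(m, n))) => //.
move=> _ [U oU <-]; rewrite setTI.
pose box (p : {ffun 'I_m * 'I_n -> rat * rat}) : set 'M[R]_(m, n) :=
  [set M | forall i j, M i j \in `](ratr (p (i, j)).1), (ratr (p (i, j)).2)[].
have -> : U = \bigcup_(p in [set p | box p `<=` U]) box p.
  apply/seteqP; split => [M UM|M [p /= pU pM]]; last exact: pU.
  have /nbhs_ballP[e /= e0 eU] : nbhs M U by exact: open_nbhs_nbhs.
  have ex ij : exists q : rat * rat,
      [&& M ij.1 ij.2 - e < ratr q.1, ratr q.1 < M ij.1 ij.2,
          M ij.1 ij.2 < ratr q.2 & ratr q.2 < M ij.1 ij.2 + e].
    have /rat_in_itvoo[q1] : M ij.1 ij.2 - e < M ij.1 ij.2.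
      by rewrite ltrBlDr ltrDl.
    rewrite in_itv/= => /andP[h1 h2].
    have /rat_in_itvoo[q2] : M ij.1 ij.2 < M ij.1 ij.2 + e by rewrite ltrDl.
    rewrite in_itv/= => /andP[h3 h4].
    by exists (q1, q2); rewrite /= h1 h2 h3 h4.
  have [q qP] := choice ex.
  exists [ffun ij => q ij] => [N NM|i j]; last first.
    by rewrite ffunE in_itv/=; have /and4P[_ -> -> _] := qP (i, j).
  apply: eU; split => // i j; have := NM i j; rewrite ffunE in_itv/=.
  have /and4P[/= h1 h2 h3 h4] := qP (i, j); move=> /andP[h5 h6].
  rewrite /ball/= ltr_distlC (lt_trans h1 h5)/=.
  by rewrite (lt_trans h6 h4).
rewrite preimage_bigcup bigcup_mkcond.
apply: countable_bigcupT_measurable => [|p]; first exact: countableP.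
case: ifPn => // _.
rewrite (_ : _ @^-1` _ = \bigcap_(i in [set: 'I_m]) \bigcap_(j in [set: 'I_n])
  ((fun t => f t i j) @^-1`
     [set` `](ratr (p (i, j)).1), (ratr (p (i, j)).2)[ : interval R])); last first.
  by apply/seteqP; split => [t h i _ j _|t h i j]; [exact: h|exact: (h i I j I)].
apply: fin_bigcap_measurable => // i _; apply: fin_bigcap_measurable => // j _.
by rewrite -[X in measurable X]setTI; apply: mf => //; exact: measurable_itv.
Qed.

Lemma measurable_mx_coord (R : realType) (m n : nat) i j :
  measurable_fun setT (fun M : 'M[R]_(m, n) => M i j).
Proof.
apply: (@measurability _ _ _ _ _ _ _
  (RGenOpens.measurableE R)).
move=> _ [_ [a [b ->] <-]]; rewrite setTI; apply: sub_sigma_algebra.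
by apply: open_comp => [M _|]; [exact: coord_continuous|exact: interval_open].
Qed.

(* One step of the recursive construction of Lebesgue measure on R^n as an
   n-fold product: the image of lebesgue_measure \x m under (x, v) |-> x :: v *)
Section lebesgue_step.
Context {R : realType} {n : nat}
  (m : {sigma_finite_measure set 'rV[R]_n -> \bar R}).

Definition rV_cons (p : measurableTypeR R * 'rV[R]_n) : 'rV[R]_n.+1 :=
  \row_j (if unlift ord0 j is Some k then p.2 0 k else p.1).

Definition rV_uncons (v : 'rV[R]_n.+1) : measurableTypeR R * 'rV[R]_n :=
  (v 0 ord0, \row_j v 0 (lift ord0 j)).

Lemma rV_consK : cancel rV_cons rV_uncons.
Proof.
case=> x v; rewrite /rV_uncons !mxE unlift_none; congr pair.
by apply/rowP => j; rewrite !mxE liftK.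
Qed.

Lemma measurable_rV_cons : measurable_fun setT rV_cons.
Proof.
apply: measurable_mx => i j; rewrite /rV_cons.
under eq_fun do rewrite mxE.
case: (unlift ord0 j) => [k|].
  by apply: (measurableT_comp (measurable_mx_coord _ _)).
exact: measurable_fst.
Qed.

Lemma measurable_rV_uncons : measurable_fun setT rV_uncons.
Proof.
apply: measurable_fun_pair; first exact: measurable_mx_coord.
by apply: measurable_mx => i j; under eq_fun do rewrite mxE; exact: measurable_mx_coord.
Qed.

Definition lebesgue_step : set 'rV[R]_n.+1 -> \bar R :=
  pushforward (@lebesgue_measure R \x m)%E rV_cons.


Let step0 : lebesgue_step set0 = 0%E.
Proof. by rewrite /lebesgue_step /pushforward preimage_set0 measure0. Qed.

Let step_ge0 A : (0 <= lebesgue_step A)%E.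
Proof. by rewrite /lebesgue_step /pushforward measure_ge0. Qed.

Let step_sigma_additive : semi_sigma_additive lebesgue_step.
Proof.
have mcons A : measurable A -> measurable (rV_cons @^-1` A).
  by move=> mA; rewrite -[X in measurable X]setTI; exact: measurable_rV_cons.
move=> F mF tF mUF; rewrite /lebesgue_step /pushforward preimage_bigcup.
apply: measure_semi_sigma_additive.
- by move=> k; exact: mcons.
- apply/trivIsetP => i j _ _ ij; rewrite -preimage_setI.
  by move/trivIsetP : tF => /(_ _ _ I I ij) ->; rewrite preimage_set0.
- by rewrite -preimage_bigcup; exact: mcons.
Qed.

HB.instance Definition _ := isMeasure.Build _ _ _ lebesgue_step
  step0 step_ge0 step_sigma_additive.

Let step_sigma_finite : sigma_finite setT lebesgue_step.
Proof.
have /sigma_finiteP[F' [F'T ndF' F'oo]] := sigma_finiteT (@lebesgue_measure R).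
have /sigma_finiteP[G [GT ndG Goo]] := sigma_finiteT m.
exists (fun k => rV_uncons @^-1` (F' k `*` G k)) => [|k].
  apply/esym/seteqP; split => // v _.
  have [i _ Fi] : (\bigcup_k F' k) (rV_uncons v).1 by rewrite -F'T.
  have [j _ Gj] : (\bigcup_k G k) (rV_uncons v).2 by rewrite -GT.
  exists (maxn i j) => //; split.
    by move: Fi; exact/subsetPset/ndF'/leq_maxl.
  by move: Gj; exact/subsetPset/ndG/leq_maxr.
have [mF Fk] := F'oo k; have [mG Gk] := Goo k; split.
  by rewrite -[X in measurable X]setTI; apply: measurable_rV_uncons => //;
    exact: measurableX.
rewrite /lebesgue_step /pushforward -comp_preimage.
rewrite (_ : _ \o _ = id); last by apply/funext => p; exact: rV_consK.
by rewrite preimage_id product_measure1E// lte_mul_pinfty// ge0_fin_numE.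
Qed.

HB.instance Definition _ :=
  Measure_isSigmaFinite.Build _ _ _ lebesgue_step step_sigma_finite.

End lebesgue_step.

Fixpoint lebesgue_rV {R : realType} n :
    {sigma_finite_measure set 'rV[R]_n -> \bar R} :=
  if n is k.+1 then
    [the {sigma_finite_measure set _ -> \bar R} of lebesgue_step (lebesgue_rV k)]
  else [the {sigma_finite_measure set _ -> \bar R} of \d_(0 : 'rV[R]_0)].

Lemma lebesgue_rV_box (R : realType) n (a b : 'rV[R]_n) :
  (forall i, a 0 i <= b 0 i) ->
  lebesgue_rV n [set v : 'rV[R]_n | forall i, a 0 i <= v 0 i <= b 0 i] =
  (\prod_(i < n) (b 0 i - a 0 i))%:E.
Proof.
elim: n a b => [|n IHn] a b ab /=.
  rewrite big_ord0 diracE mem_set//; by case.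
rewrite /lebesgue_step /pushforward.
pose c (v : 'rV[R]_n.+1) := (rV_uncons v).2.
set X := _ @^-1` _.
have -> : X = [set` `[a 0 0, b 0 0]] `*`
    [set v : 'rV[R]_n | forall i, c a 0 i <= v 0 i <= c b 0 i].
  apply/seteqP; split => [[x v] /= h|[x v] /= [h1 h2] i].
    split; first by have := h 0; rewrite mxE unlift_none in_itv.
    by move=> i; have := h (lift 0 i); rewrite !mxE liftK.
  rewrite mxE; case: unliftP => [j|] ->; last by move: h1; rewrite in_itv.
  by have := h2 j; rewrite !mxE.
rewrite product_measure1E//; last first.
  rewrite (_ : mkset _ = \bigcap_(i in [set: 'I_n])
     ((fun v : 'rV[R]_n => v 0 i) @^-1` [set` `[c a 0 i, c b 0 i]])); last first.
    by apply/seteqP; split => v /= h i; [move=> _; rewrite /= in_itv; exact: h|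
      have := h i I; rewrite /= in_itv].
  apply: fin_bigcap_measurable => // i _; rewrite -[X in measurable X]setTI.
  by apply: measurable_mx_coord => //; exact: measurable_itv.
rewrite IHn => [|i]; last by rewrite !mxE.
rewrite [X in (X * _)%E](_ : _ = (b 0 0 - a 0 0)%:E).
  rewrite -EFinM big_ord_recl; congr (_ * _)%:E.
  by apply: eq_bigr => i _; rewrite !mxE.
rewrite [LHS](lebesgue_measure_itv `[a 0 0, b 0 0]) /= lte_fin -EFinD; case: ltP => //.
by move=> ba; rewrite (le_anti (introT andP (conj (ab 0) ba))) subrr.
Qed.

Section nonlocal_problem.
Context {R : realType} {N : nat}.
Notation RN := 'rV[R]_N.
Notation leb := (@lebesgue_rV R N).

Definition bounded_domain (Omega : set RN) : Prop :=
  [/\ open Omega, connected Omega, bounded_set Omega & Omega !=set0].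

Definition admissible_kernel (V : RN -> RN -> R) : Prop :=
  [/\ continuous (fun p : RN * RN => V p.1 p.2),
      forall x y, 0 <= V x y,
      forall x, 0 < V x x,
      forall x y, V x y = V y x &
      forall x, (\int[leb]_y (V x y)%:E = 1)%E].

Definition measurable_partition (A B : set RN) : Prop :=
  [/\ measurable A, measurable B, A `|` B = setT & A `&` B = set0].

(* Ob stands for the closure of the domain. J acts inside A, G inside B, and K
   (written R in the usual J, G, R notation) across the two sets. *)
Variables (Ob A B : set RN) (J G K : RN -> RN -> R).

(* This is applied to all bounded measurable g, not only to those supported in
   Ob, so that it determines the rates of the jumps landing outside Ob. *)
Definition jump_generator (g : RN -> R) (x : RN) : R :=
  \1_(A `&` Ob) x * (\int[leb]_y (\1_A y * J x y * (g y - g x))) +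
  \1_(B `&` Ob) x * (\int[leb]_y (\1_B y * G x y * (g y - g x))) +
  \1_(A `&` Ob) x * (\int[leb]_y (\1_B y * K x y * (g y - g x))) +
  \1_(B `&` Ob) x * (\int[leb]_y (\1_A y * K x y * (g y - g x))).

Definition escape_rate (x : RN) : R :=
  \1_(A `&` Ob) x * (\int[leb]_(y in ~` Ob) (\1_A y * J x y) +
                     \int[leb]_(y in ~` Ob) (\1_B y * K x y)) +
  \1_(B `&` Ob) x * (\int[leb]_(y in ~` Ob) (\1_A y * K x y) +
                     \int[leb]_(y in ~` Ob) (\1_B y * G x y)).

Definition dirichlet_solution (f u : RN -> R) : Prop :=
  [/\ measurable_fun setT u,
      leb.-integrable setT (fun y => (u y ^+ 2)%:E),
      forall x, ~ Ob x -> u x = 0 &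
      forall x, Ob x -> f x =
        \1_A x * (\int[leb]_(y in A) (J x y * (u y - u x))) +
        \1_A x * (\int[leb]_(y in B) (K x y * (u y - u x))) +
        \1_B x * (\int[leb]_(y in A) (K x y * (u y - u x))) +
        \1_B x * (\int[leb]_(y in B) (G x y * (u y - u x)))].

End nonlocal_problem.

Section markov_process.
Context {R : realType} {N : nat} {d : measure_display} {W : measurableType d}.
Notation RN := 'rV[R]_N.
Variables (P : RN -> probability W R) (Z : R -> W -> RN).

Definition history (s : R) : set (set W) :=
  <<s [set E | exists r (C : set RN),
        [/\ 0 <= r <= s, measurable C & E = Z r @^-1` C]] >>.

(* A time-homogeneous Markov family (P x is the law of the process started at
   x) whose paths are right-continuous step functions with finitely many jumps
   on bounded time intervals. Only times t >= 0 are meaningful. *)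
Record pure_jump_markov : Prop := PureJumpMarkov {
  process_measurable : forall t : R, 0 <= t -> measurable_fun setT (Z t);
  transition_measurable : forall (t : R) (C : set RN),
    0 <= t -> measurable C ->
    measurable_fun setT (fun x => P x (Z t @^-1` C));
  process_start : forall x, P x (Z 0 @^-1` [set x]) = 1%E;
  path_right : forall w (t : R), 0 <= t -> \forall s \near t^'+, Z s w = Z t w;
  path_left : forall w (t : R), 0 < t -> exists z, \forall s \near t^'-, Z s w = z;
  markov_property : forall x (s t : R) (E : set W) (C : set RN),
    0 <= s -> 0 <= t -> history s E -> measurable C ->
    (P x (E `&` Z (s + t) @^-1` C) =
     \int[P x]_(w in E) P (Z s w) (Z t @^-1` C))%E }.

Definition absorbed_outside (D : set RN) : Prop :=
  forall w (s t : R), 0 <= s -> s <= t -> ~ D (Z s w) -> Z t w = Z s w.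

(* L is the infinitesimal generator, in sup norm, of the transition semigroup
   (t, g) |-> (x |-> E^x[g(Z_t)]) on bounded measurable functions. *)
Definition has_generator (L : (RN -> R) -> RN -> R) : Prop :=
  forall g : RN -> R, measurable_fun setT g -> [bounded g x | x in setT] ->
  forall e, 0 < e -> \forall t \near (0 : R)^'+, forall x,
    `|(fine 'E_(P x)[g \o Z t] - g x) / t - L g x| <= e.

Definition exit_time (D : set RN) (w : W) : \bar R :=
  ereal_inf [set t%:E | t in [set t : R | 0 <= t /\ ~ D (Z t w)]].

End markov_process.

(* Main.v *)
Require Import Defs.
From HB Require Import structures.
From mathcomp Require Import all_boot all_order all_algebra.
From mathcomp Require Import all_classical all_reals all_analysis.
From mathcomp Require Import measurable_realfun giry.
From mathcomp Require Import lra ring.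

Set Implicit Arguments.
Unset Strict Implicit.
Unset Printing Implicit Defensive.

Import Order.TTheory GRing.Theory Num.Theory.
Import numFieldNormedType.Exports.

Local Open Scope classical_set_scope.
Local Open Scope ring_scope.

(** Write [S t g x] for the expectation of [g (Z t)] under [P x], and [D] for
    the closed set outside which the process is frozen.

    The Markov property makes [S] a semigroup on bounded measurable functions
    ([semigroup_add]). Since the generator [L] is a uniform limit of difference
    quotients, [S (t + h) g = S t g + h * S t (L g) + o(h)] uniformly in [t] and
    in the starting point ([semigroup_taylor]), so that [t |-> S t g x] has the
    continuous derivative [S t (L g) x] on the half-line
    ([is_derive_semigroup]).

    Take first [g = \1_D]. A direct computation gives [L \1_D = - q], where [q]
    is the escape rate ([generator_indic]), and [q >= q0 * \1_D] with
    [q0 = inf q > 0]. The survival probability [phi t = S t \1_D x] is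
    nonincreasing and satisfies [phi' <= - q0 * phi], whence
    [phi T <= 1 / (1 + q0 * T)] ([survival_decay]). Thus the process leaves [D]
    almost surely ([exit_time_finite]), and [S t g x] tends to 0 for every bounded [g]
    vanishing outside [D] ([cvg_killed_semigroup]).

    Integrating the derivative over the half-line gives, for such a [g], that
    the integral over [t >= 0] of [S t (L g) x] is [- g x]
    ([ge0_integral_generator] for [L g >= 0]). If [L g] is merely bounded and
    zero outside [D], the same follows by adding to [g] a multiple of [- \1_D],
    whose generator image [q] is positive on [D] and dominates [L g] up to a
    constant; Fubini's theorem then exchanges time and expectation
    ([expectation_occupation]).

    The theorem is the case [g = u]. The Dirichlet problem says exactly that
    [L u = \1_D * f] ([generator_dirichlet_solution]), and before the exit time
    the path lies in [D], afterwards outside ([lt_exit_time]). The only other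
    point is that [u], assumed merely square integrable, is bounded: the equation
    expresses the total jump rate at [x] times [u x] through [f x] and the
    integral of [u] against the kernels; these are bounded on the compact set
    [D], and the total rate is at least [q0]
    ([dirichlet_solution_bounded]). *)

(** * Bounded measurable functions *)

Section bounded_measurable.
Context {d : measure_display} {T : measurableType d} {R : realType}.

Definition bounded_measurable (g : T -> R) :=
  measurable_fun setT g /\ exists M : R, forall x, `|g x| <= M.

End bounded_measurable.

Section bounded_measurable_theory.
Context {d : measure_display} {T : measurableType d} {R : realType}.
Implicit Types g h : T -> R.

Lemma bounded_measurableD g h : bounded_measurable g -> bounded_measurable h ->
  bounded_measurable (fun x => g x + h x).
Proof.
move=> [mg [M gM]] [mh [M' hM]]; split; first exact: measurable_funD.
by exists (M + M') => x; rewrite (le_trans (ler_normD _ _))// lerD.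
Qed.

Lemma bounded_measurableZ c g : bounded_measurable g ->
  bounded_measurable (fun x => c * g x).
Proof.
move=> [mg [M gM]]; split; first exact: measurable_funM.
by exists (`|c| * M) => x; rewrite normrM ler_wpM2l.
Qed.

Lemma bounded_measurable_comp d' (T' : measurableType d') (h : T' -> T) g :
  measurable_fun setT h -> bounded_measurable g ->
  bounded_measurable (fun x => g (h x)).
Proof.
move=> mh [mg [M gM]]; split; first exact: measurableT_comp.
by exists M => x; exact: gM.
Qed.

Lemma bounded_measurable_integrable (P : probability T R) g :
  bounded_measurable g -> P.-integrable setT (EFin \o g).
Proof.
move=> [mg [M gM]]; apply: measurable_bounded_integrable => //.
  by rewrite (le_lt_trans (probability_le1 _ _))// ltry.
by exists M; split; [exact: num_real|move=> N MN x _; exact: le_trans (gM x) (ltW MN)].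
Qed.

Lemma bounded_measurable_bounded g :
  bounded_measurable g -> [bounded g x | x in setT].
Proof.
move=> [_ [M gM]]; exists M; split; first exact: num_real.
by move=> N MN x _ /=; exact: le_trans (gM x) (ltW MN).
Qed.

End bounded_measurable_theory.

Lemma closed_measurable_mx (R : realType) m n (C : set 'M[R]_(m, n)) :
  closed C -> measurable C.
Proof.
move=> cC; rewrite -(setCK C); apply: measurableC.
by apply: sub_sigma_algebra; exact: closed_openC.
Qed.

(** * The transition semigroup *)

Section semigroup.
Context {R : realType} {N : nat} {d : measure_display} {W : measurableType d}.
Notation RN := 'rV[R]_N.
Context {P : RN -> probability W R} {Z : R -> W -> RN}.
Context (mZ : pure_jump_markov P Z).
Implicit Types (g h : RN -> R) (s t : R) (x : RN).

Definition semigroup_of (P : RN -> probability W R) (Z : R -> W -> RN)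
  (t : R) (g : RN -> R) (x : RN) : R := \int[P x]_w g (Z t w).
Local Notation S := (semigroup_of P Z).

Lemma expectation_semigroup t g x : fine ('E_(P x)[g \o Z t]) = S t g x.
Proof. by rewrite expectation.unlock. Qed.

Lemma bounded_measurable_process t g : 0 <= t -> bounded_measurable g ->
  bounded_measurable (fun w => g (Z t w)).
Proof. by move=> t0; apply/bounded_measurable_comp/(process_measurable mZ). Qed.

Lemma integrable_process t g x : 0 <= t -> bounded_measurable g ->
  (P x).-integrable setT (fun w => (g (Z t w))%:E).
Proof.
by move=> t0 bg; apply: bounded_measurable_integrable; exact: bounded_measurable_process.
Qed.
Hint Resolve integrable_process : core.

Lemma semigroupD t g h x : 0 <= t -> bounded_measurable g -> bounded_measurable h ->
  S t (fun y => g y + h y) x = S t g x + S t h x.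
Proof. by move=> t0 bg bh; rewrite /S RintegralD//; exact: integrable_process. Qed.

Lemma semigroupZ t c g x : 0 <= t -> bounded_measurable g ->
  S t (fun y => c * g y) x = c * S t g x.
Proof. by move=> t0 bg; rewrite /S RintegralZl//; exact: integrable_process. Qed.

Lemma bounded_measurable_cst (c : R) : bounded_measurable (fun _ : RN => c).
Proof. by split; [exact: measurable_cst|exists `|c|]. Qed.

Lemma semigroup_cst t c x : S t (fun=> c) x = c.
Proof. by rewrite /S Rintegral_cst//= probability_setT/= mulr1. Qed.

Lemma le_semigroup t g h x : 0 <= t -> bounded_measurable g ->
  bounded_measurable h -> (forall y, g y <= h y) -> S t g x <= S t h x.
Proof.
by move=> t0 bg bh gh; apply: le_Rintegral => //; exact: integrable_process.
Qed.

Lemma normr_semigroup t g x M : 0 <= t -> bounded_measurable g ->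
  (forall y, `|g y| <= M) -> `|S t g x| <= M.
Proof.
move=> t0 bg gM; rewrite ler_norml; apply/andP; split.
  rewrite -(semigroup_cst t (- M) x); apply: le_semigroup => //.
    exact: bounded_measurable_cst.
  by move=> y; have := gM y; rewrite ler_norml => /andP[].
rewrite -[leRHS](semigroup_cst t M x); apply: le_semigroup => //.
  exact: bounded_measurable_cst.
by move=> y; have := gM y; rewrite ler_norml => /andP[].
Qed.

(* The law of [Z t] as a point of the Giry monad: the Markov property on events
   is then an identity between a law and a monadic composition, and integration
   against a composition extends it from events to functions. *)
Let law t (t0 : 0 <= t) (x : RN) : giry RN R :=
  giry_map (process_measurable mZ t0) (P x).

Let measurable_law t (t0 : 0 <= t) : measurable_fun setT (law t0).
Proof.
apply: measurable_giry_codensity => // C mC.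
exact: transition_measurable mZ t C t0 mC.
Qed.

Let law_int t (t0 : 0 <= t) x (g : RN -> R) : measurable_fun setT g ->
  (forall y, 0 <= g y) ->
  giry_int (law t0 x) (EFin \o g) = (\int[P x]_w (g (Z t w))%:E)%E.
Proof.
move=> mg g0; rewrite giry_int_map//; exact/measurable_EFinP.
Qed.

Let semigroup_fin t x g : 0 <= t -> bounded_measurable g ->
  (\int[P x]_w (g (Z t w))%:E)%E = (S t g x)%:E.
Proof.
move=> t0 bg; rewrite /S /Rintegral fineK//; apply: integrable_fin_num.
  exact: measurableT.
exact: integrable_process.
Qed.

Let measurable_ge0_semigroup t g : 0 <= t -> bounded_measurable g ->
  (forall y, 0 <= g y) -> measurable_fun setT (S t g).
Proof.
move=> t0 bg g0; apply/measurable_EFinP.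
rewrite (_ : _ \o _ = giry_int ^~ (EFin \o g) \o law t0); last first.
  by apply/funext => x /=; rewrite law_int ?semigroup_fin//; case: bg.
apply: measurableT_comp => //; apply: measurable_giry_int.
  by apply/measurable_EFinP; case: bg.
by move=> y; rewrite lee_fin.
Qed.

Let law_bind s t (s0 : 0 <= s) (t0 : 0 <= t) (st0 : 0 <= s + t) x C :
  measurable C ->
  giry_bind (law s0 x) (measurable_law t0) C = law st0 x C.
Proof.
move=> mC; have := markov_property mZ x s0 t0 _ mC => /(_ setT).
rewrite setTI => e; rewrite [RHS]e; last first.
  by rewrite -setC0; apply: sigma_algebraC; exact: sigma_algebra0.
rewrite /giry_bind /= /giry_join /giry_int/=.
transitivity (giry_int (giry_map (measurable_law t0) (law s0 x)) (giry_ev ^~ C)) => //.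
rewrite giry_int_map//; last exact: measurable_giry_ev.
rewrite giry_int_map//.
by apply: measurableT_comp => //; exact: measurable_giry_ev.
Qed.

Let ge0_semigroup_add s t g x : 0 <= s -> 0 <= t -> bounded_measurable g ->
  (forall y, 0 <= g y) -> S (s + t) g x = S s (S t g) x.
Proof.
move=> s0 t0 bg g0; have st0 : 0 <= s + t by exact: addr_ge0.
have mg : measurable_fun setT (EFin \o g) by apply/measurable_EFinP; case: bg.
rewrite /S /Rintegral; congr fine.
transitivity (giry_int (law st0 x) (EFin \o g)).
  by rewrite law_int//; case: bg.
transitivity (giry_int (giry_bind (law s0 x) (measurable_law t0)) (EFin \o g)).
  by apply: eq_measure_integral => C mC _; exact/esym/law_bind.
rewrite giry_int_bind//.
transitivity (giry_int (law s0 x) (EFin \o S t g)).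
  apply: eq_integral => y _; rewrite law_int//; last by case: bg.
  exact: semigroup_fin.
rewrite law_int//; first exact: measurable_ge0_semigroup.
by move=> y; exact: Rintegral_ge0.
Qed.

(* A bounded function becomes nonnegative after adding a constant, and [S t]
   preserves constants: this reduces bounded functions to nonnegative ones. *)
Let shift_ge0 g : bounded_measurable g ->
  exists2 M, bounded_measurable (fun y => g y + M) & forall y, 0 <= g y + M.
Proof.
move=> bg; have [mg [M gM]] := bg; exists M.
  by apply: bounded_measurableD => //; exact: bounded_measurable_cst.
by move=> y; have := gM y; rewrite ler_norml => /andP[+ _]; rewrite -lerBlDr sub0r.
Qed.

Let semigroup_shift t g M : 0 <= t -> bounded_measurable g ->
  S t g = (fun x => S t (fun y => g y + M) x + - M).
Proof.
move=> t0 bg; apply/funext => x; rewrite semigroupD//; last first.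
  exact: bounded_measurable_cst.
by rewrite semigroup_cst addrK.
Qed.

Lemma bounded_measurable_semigroup t g : 0 <= t -> bounded_measurable g ->
  bounded_measurable (S t g).
Proof.
move=> t0 bg; split; last first.
  by have [_ [M gM]] := bg; exists M => x; exact: normr_semigroup.
have [M bgM g0] := shift_ge0 bg; rewrite (semigroup_shift M)//.
by apply: measurable_funD => //; exact: measurable_ge0_semigroup.
Qed.

(** The Markov property for functions instead of events. *)
Lemma semigroup_add s t g x : 0 <= s -> 0 <= t -> bounded_measurable g ->
  S (s + t) g x = S s (S t g) x.
Proof.
move=> s0 t0 bg; have [M bgM g0] := shift_ge0 bg.
rewrite (semigroup_shift M)//; last exact: addr_ge0.
rewrite ge0_semigroup_add// [in RHS](@semigroup_shift t g M)//.
rewrite semigroupD//; last exact: bounded_measurable_cst.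
  by rewrite semigroup_cst.
exact: bounded_measurable_semigroup.
Qed.

Lemma semigroup0 g x : bounded_measurable g -> S 0 g x = g x.
Proof.
move=> bg; rewrite /S (_ : g x = \int[P x]_w cst (g x) w); last first.
  by rewrite Rintegral_cst//= probability_setT mulr1.
congr fine; apply: ae_eq_integral => //.
- exact: (measurable_int _ (integrable_process x (lexx 0) bg)).
- exact/measurable_EFinP/measurable_cst.
- have E : measurable (Z 0 @^-1` [set x]).
    rewrite -[X in measurable X]setTI; apply: (process_measurable mZ) => //.
    by apply: closed_measurable_mx; exact/accessible_closed_set1/hausdorff_accessible/norm_hausdorff.
  exists (~` (Z 0 @^-1` [set x])); split; first exact: measurableC.
    rewrite [LHS](probability_setC (P x))//.
    by have := process_start mZ x => ->; rewrite subee.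
  by move=> w /= h e; apply: h => _; rewrite e.
Qed.

End semigroup.

(** * The generator and the derivative of the semigroup *)

Lemma near_right (R : realType) (a : R) (Q : R -> Prop) :
  (\forall t \near a^'+, Q t) ->
  exists2 e, 0 < e & forall t, a < t < a + e -> Q t.
Proof.
rewrite near_withinE => /nbhs_ballP[e/= e0 H]; exists e => // t /andP[at_ te].
by apply: H => //; rewrite /ball/= distrC gtr0_norm ?subr_gt0// ltrBlDl.
Qed.

Section generator.
Context {R : realType} {N : nat} {d : measure_display} {W : measurableType d}.
Notation RN := 'rV[R]_N.
Context {P : RN -> probability W R} {Z : R -> W -> RN} {L : (RN -> R) -> RN -> R}.
Context (mZ : pure_jump_markov P Z) (genL : has_generator P Z L).
Implicit Types (g h : RN -> R) (s t : R) (x : RN).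
Local Notation S := (semigroup_of P Z).

Lemma generator_uniform g (e : R) : bounded_measurable g -> 0 < e ->
  exists2 r, 0 < r & forall t x, 0 < t < r ->
    `|S t g x - g x - t * L g x| <= e * t.
Proof.
move=> bg e0.
have := genL (proj1 bg) (bounded_measurable_bounded bg) e0.
move=> /near_right[r r0 H]; rewrite add0r in H; exists r => // t x /[dup] /andP[t0 _] /H/(_ x).
rewrite expectation_semigroup => le_e.
rewrite (_ : _ - _ = ((S t g x - g x) / t - L g x) * t); last first.
  by field; rewrite gt_eqF.
by rewrite normrM (gtr0_norm t0) ler_pM2r.
Qed.

(** [L g] is a uniform limit of the difference quotients [(S t g - g) / t], which
    are bounded and measurable; this holds whatever formula defines [L]. *)
Lemma bounded_measurable_generator g : bounded_measurable g ->
  bounded_measurable (L g).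
Proof.
move=> bg; split.
  pose q n x := (S n.+1%:R^-1 g x - g x) * n.+1%:R.
  apply: (@measurable_fun_cvg _ _ _ _ q) => [n|x _].
    apply: measurable_funM => //; apply: measurable_funB; last by case: bg.
    by apply: (proj1 (bounded_measurable_semigroup mZ _ bg)); rewrite invr_ge0.
  apply/cvgrPdist_le => e e0.
  have [r r0 H] := generator_uniform bg e0.
  near=> n; have n0 : 0 < n.+1%:R :> R by [].
  have nr : n.+1%:R^-1 < r.
    by near: n; exact: (near_infty_natSinv_lt (PosNum r0)).
  have := H n.+1%:R^-1 x; rewrite invr_gt0 n0 nr => /(_ isT) le_e.
  rewrite distrC (_ : _ - _ =
    (S n.+1%:R^-1 g x - g x - n.+1%:R^-1 * L g x) * n.+1%:R); last first.
    by rewrite /q; field; rewrite nat1r pnatr_eq0.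
  by rewrite normrM (gtr0_norm n0) -ler_pdivlMr.
have [r r0 H] := generator_uniform bg ltr01.
have [_ [M gM]] := bg.
have [t0 tr] : 0 < r / 2 /\ r / 2 < r by split; lra.
exists ((r / 2 + M + M) / (r / 2)) => x.
rewrite ler_pdivlMr// -{1}(gtr0_norm t0) -normrM mulrC.
have := H (r / 2) x; rewrite t0 tr => /(_ isT).
have := normr_semigroup mZ x (ltW t0) bg gM; have := gM x.
rewrite !ler_norml => /andP[h1 h2] /andP[h3 h4] /andP[h5 h6].
by apply/andP; split; lra.
Unshelve. all: by end_near. Qed.

(** The expansion at time 0 is uniform in the starting point, so it can be
    transported to time [s] by applying the contraction [S s]. *)
Lemma semigroup_taylor g (e : R) : bounded_measurable g -> 0 < e ->
  exists2 r, 0 < r & forall s t x, 0 <= s -> s < t < s + r ->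
    `|S t g x - S s g x - (t - s) * S s (L g) x| <= e * (t - s).
Proof.
move=> bg e0; have [r r0 H] := generator_uniform bg e0.
exists r => // s t x s0 /andP[st tr].
have h0 : 0 < t - s by rewrite subr_gt0.
have bS : bounded_measurable (S (t - s) g).
  by apply: (bounded_measurable_semigroup mZ) => //; exact: ltW.
have bL := bounded_measurable_generator bg.
pose q y := S (t - s) g y + -1 * g y + - (t - s) * L g y.
have bq1 : bounded_measurable (fun y => S (t - s) g y + -1 * g y).
  by apply: bounded_measurableD => //; exact: bounded_measurableZ.
have bq : bounded_measurable q.
  by apply: bounded_measurableD => //; exact: bounded_measurableZ.
have -> : S t g x - S s g x - (t - s) * S s (L g) x = S s q x.
  rewrite /q (semigroupD mZ)//; last exact: bounded_measurableZ.
  rewrite (semigroupD mZ)//; last exact: bounded_measurableZ.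
  rewrite !(semigroupZ mZ)// -(semigroup_add mZ)//; last exact: ltW.
  by rewrite (addrC s) subrK; ring.
apply: (normr_semigroup mZ) => // y; rewrite /q mulN1r mulNr; apply: H.
by rewrite h0/=; lra.
Qed.

Lemma semigroup_equicontinuous g (e : R) : bounded_measurable g -> 0 < e ->
  exists2 r, 0 < r & forall s t x, 0 <= s -> s <= t < s + r ->
    `|S t g x - S s g x| <= e.
Proof.
move=> bg e0; have [r r0 H] := semigroup_taylor bg ltr01.
have bL := bounded_measurable_generator bg; have [_ [M LM]] := bL.
have M0 : 0 <= M by exact: le_trans (LM 0).
have M1 : 0 < M + 1 by lra.
exists (Num.min r (e / (M + 1))); first by rewrite lt_min r0 divr_gt0.
move=> s t x s0; rewrite -ltrBlDl lt_min ltr_pdivlMr// => /and3P[st' tr te].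
have [->|st] := eqVneq s t; first by rewrite subrr normr0 ltW.
have {st'}st : s < t by rewrite lt_neqAle st.
have h0 : 0 < t - s by rewrite subr_gt0.
have := H s t x s0; rewrite st -ltrBlDl tr => /(_ isT).
have := normr_semigroup mZ x s0 bL LM; rewrite -(ler_pM2l h0) -{1}(gtr0_norm h0).
rewrite -normrM !ler_norml => /andP[h1 h2] /andP[h3 h4].
by apply/andP; split; lra.
Qed.

(** Truncating times below at 0 extends the orbit by a constant to the negative
    half-line, so that continuity and derivatives make sense on the whole line. *)
Lemma continuous_semigroup g x : bounded_measurable g ->
  continuous (fun t => S (Num.max t 0) g x).
Proof.
move=> bg t; apply/cvgrPdist_le => e e0.
have [r r0 H] := semigroup_equicontinuous bg e0.
near=> u.
have : `|t - u| < r by near: u; exact: cvgr_dist_lt.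
rewrite ltr_norml => /andP[h1 h2].
have m0 (v : R) : 0 <= Num.max v 0 by rewrite le_max lexx orbT.
have [tu|ut] := leP t u.
  rewrite distrC; apply: H => //; rewrite /Num.max.
  by apply/andP; split; do 2 case: ifPn; rewrite -?leNgt; lra.
apply: H => //; rewrite /Num.max.
by apply/andP; split; do 2 case: ifPn; rewrite -?leNgt; lra.
Unshelve. all: by end_near. Qed.

(** The right derivative is the uniform expansion at [t]. For the left derivative
    the expansion is used at the earlier time, and [S] applied to [L g] there is
    close to its value at [t] by equicontinuity. *)
Lemma is_derive_semigroup g x t : bounded_measurable g -> 0 < t ->
  is_derive t 1 (fun t => S (Num.max t 0) g x) (S t (L g) x).
Proof.
move=> bg t0; have bL := bounded_measurable_generator bg.
suff dS : h^-1 *: (S (Num.max (h *: 1 + t) 0) g x - S (Num.max t 0) g x)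
    @[h --> 0^'] --> S t (L g) x.
  by apply: DeriveDef; [apply/cvg_ex; eexists; exact: dS|exact: cvg_lim].
apply/cvgrPdist_le => e e0.
have e20 : 0 < e / 2 by rewrite divr_gt0.
have [r r0 H] := semigroup_taylor bg e20.
have [r' r'0 H'] := semigroup_equicontinuous bL e20.
near=> h.
have h0 : h != 0 by near: h; exact: nbhs_dnbhs_neq.
have hr : `|h| < Num.min t (Num.min r r').
  by near: h; apply: dnbhs0_lt; rewrite !lt_min t0 r0.
move: hr; rewrite !lt_min => /and3P[ht hr hr'].
rewrite [h *: 1]mulr1 -[_ *: _]/(_ * _) (max_l (ltW t0)) max_l; last first.
  by move: ht; rewrite ltr_norml => /andP[]; lra.
set D := S t (L g) x.
rewrite (_ : _ - _ = - (S (h + t) g x - S t g x - h * D) / h); last by field.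
rewrite normrM normrV ?unitfE// ler_pdivrMr ?normr_gt0// normrN.
have [hp|hn|h00] := ltgtP 0 h; last by rewrite -h00 eqxx in h0.
- rewrite gtr0_norm// in hr ht hr' *.
  have := H t (h + t) x (ltW t0); rewrite addrK => /(_ _)/le_trans; apply.
    by apply/andP; split; lra.
  by rewrite ler_pM2r//; lra.
- rewrite ltr0_norm// in hr ht hr' *.
  have s0 : 0 <= h + t by lra.
  have st : h + t < t by lra.
  have := H (h + t) t x s0; rewrite st/= => /(_ _).
  have := H' (h + t) t x s0; rewrite (ltW st)/= => /(_ _).
  have -> : t < h + t + r by lra.
  have -> : t < h + t + r' by lra.
  have -> : t - (h + t) = - h by ring.
  move=> /(_ isT) + /(_ isT); rewrite -/D.
  have h0' : 0 < - h by lra.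
  rewrite -(ler_pM2r h0') -{1}(gtr0_norm h0') -normrM.
  rewrite !ler_norml => /andP[h1 h2] /andP[h3 h4].
  by apply/andP; split; lra.
Unshelve. all: by end_near. Qed.

Lemma cvg_generator g x : bounded_measurable g ->
  t^-1 * (S t g x - g x) @[t --> 0^'+] --> L g x.
Proof.
move=> bg; apply/cvgrPdist_le => e e0.
have := genL (proj1 bg) (bounded_measurable_bounded bg) e0.
by apply: filterS => t /(_ x); rewrite expectation_semigroup distrC mulrC.
Qed.

Lemma generatorD g h : bounded_measurable g -> bounded_measurable h ->
  L (fun y => g y + h y) = (fun y => L g y + L h y).
Proof.
move=> bg bh; apply/funext => x.
have := @cvg_generator _ x (bounded_measurableD bg bh).
move/(cvg_unique (@norm_hausdorff _ R^o)); apply => /=.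
apply: cvg_trans (cvgD (@cvg_generator _ x bg) (@cvg_generator _ x bh)).
apply: near_eq_cvg; near=> t.
have t0 : 0 <= t by apply/ltW; near: t; exact: nbhs_right_gt.
by rewrite (semigroupD mZ)// -[LHS]/(_ * _ + _ * _); ring.
Unshelve. all: by end_near. Qed.

Lemma generatorZ c g : bounded_measurable g ->
  L (fun y => c * g y) = (fun y => c * L g y).
Proof.
move=> bg; apply/funext => x.
have := @cvg_generator _ x (bounded_measurableZ c bg).
move/(cvg_unique (@norm_hausdorff _ R^o)); apply => /=.
apply: cvg_trans (cvgM (cvg_cst c) (@cvg_generator _ x bg)).
apply: near_eq_cvg; near=> t.
have t0 : 0 <= t by apply/ltW; near: t; exact: nbhs_right_gt.
by rewrite (semigroupZ mZ)// -[LHS]/(c * (_ * _)); ring.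
Unshelve. all: by end_near. Qed.

(** Fundamental theorem of calculus on the half-line: the initial value is [g x]
    and the limit at infinity is 0. *)
Lemma ge0_integral_generator g x : bounded_measurable g ->
  (forall y, 0 <= L g y) -> S t g x @[t --> +oo] --> 0 ->
  (\int[lebesgue_measure]_(t in `[0%R, +oo[) (S t (L g) x)%:E = (- g x)%:E)%E.
Proof.
move=> bg Lg0 Sg0; have bL := bounded_measurable_generator bg.
transitivity (\int[lebesgue_measure]_(t in `[0%R, +oo[)
    (S (Num.max t 0) (L g) x)%:E)%E.
  by apply: eq_integral => t; rewrite inE/= in_itv/= andbT => t0; rewrite max_l.
rewrite (@ge0_continuous_FTC2y _ _ (fun t => S (Num.max t 0) g x) 0 0).
- by rewrite max_l// (semigroup0 mZ)// sub0e.
- by move=> t t0; exact: Rintegral_ge0.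
- by apply: continuous_subspaceT; exact: continuous_semigroup.
- move: Sg0; apply: cvg_trans; apply: near_eq_cvg; near=> t.
  by rewrite max_l//; near: t; exact: nbhs_pinfty_ge.
- by move=> t t0; have [] := is_derive_semigroup x bg t0.
- apply: cvg_at_right_filter; exact: continuous_semigroup.
- move=> t; rewrite in_itv/= andbT => t0; rewrite derive1E (max_l (ltW t0)).
  by have [_ ->] := is_derive_semigroup x bg t0.
Unshelve. all: by end_near. Qed.

End generator.

(** * Joint measurability of the paths *)

Lemma measurable_nat_cases d (T : measurableType d) d' (T' : measurableType d')
    (k : T -> nat) (G : nat -> T -> T') :
  (forall i, measurable (k @^-1` [set i])) ->
  (forall i, measurable_fun setT (G i)) ->
  measurable_fun setT (fun p => G (k p) p).
Proof.
move=> mk mG _ Y mY; rewrite setTI.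
rewrite (_ : _ @^-1` _ = \bigcup_i (k @^-1` [set i] `&` G i @^-1` Y)).
  apply: bigcupT_measurable => i; apply: measurableI => //.
  by rewrite -[X in measurable X]setTI; exact: mG.
by apply/seteqP; split => [p /= Yp|p [i _] /= [->//]]; exists (k p).
Qed.

Section paths.
Context {R : realType} {N : nat} {d : measure_display} {W : measurableType d}.
Notation RN := 'rV[R]_N.
Context {P : RN -> probability W R} {Z : R -> W -> RN}.
Context (mZ : pure_jump_markov P Z).

(** Sampling the path at the first multiple of [1 / (n + 1)] after [t] is jointly
    measurable. The sample times tend to [t] from the right, and the path is
    constant on a right neighbourhood of [t], so the samples are eventually equal
    to the value at [t]. *)
Lemma measurable_path (g : RN -> R) : measurable_fun setT g ->
  measurable_fun setT
    (fun p : W * measurableTypeR R => g (Z (Num.max p.2 0) p.1)).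
Proof.
move=> mg.
have m0 (v : R) : 0 <= Num.max v 0 by rewrite le_max lexx orbT.
pose k n (p : W * measurableTypeR R) := Num.truncn (n.+1%:R * Num.max p.2 0).
pose G n i (p : W * measurableTypeR R) := g (Z (i.+1%:R / n.+1%:R) p.1).
apply: (@measurable_fun_cvg _ _ _ _ (fun n p => G n (k n p) p)) => [n|[w t] _ /=].
  apply: measurable_nat_cases => i.
    rewrite (_ : _ @^-1` _ = (fun p : W * measurableTypeR R =>
      n.+1%:R * Num.max p.2 0) @^-1` [set` `[i%:R, i.+1%:R[]); last first.
      apply/seteqP; split => p /=; rewrite in_itv/= -truncn_eq ?mulr_ge0//.
        by move/eqP.
      by move/eqP.
    rewrite -[X in measurable X]setTI.
    apply: (_ : measurable_fun setT _) => //.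
    apply: measurable_funM => //; apply: measurable_maxr => //.
  apply: measurableT_comp => //; apply: measurableT_comp measurable_fst.
  by apply: (process_measurable mZ); rewrite divr_ge0.
have [r r0 Zr] := near_right (path_right mZ w (m0 t)).
apply: cvg_near_cst; near=> n; rewrite /G /k/= Zr//.
have n0 : 0 < n.+1%:R :> R by [].
have nr : n.+1%:R^-1 < r by near: n; exact: (near_infty_natSinv_lt (PosNum r0)).
have /andP[h1 h2] := truncn_itv (mulr_ge0 (ltW n0) (m0 t)).
rewrite ltr_pdivlMr// mulrC h2/= ltr_pdivrMr//.
move: nr; rewrite -(ltr_pM2l n0) mulfV ?gt_eqF// => nr.
by rewrite -natr1 mulrDl; lra.
Unshelve. all: by end_near. Qed.

End paths.

(** * Exit times *)

Section exit_times.
Context {R : realType} {N : nat} {d : measure_display} {W : measurableType d}.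
Notation RN := 'rV[R]_N.
Context {P : RN -> probability W R} {Z : R -> W -> RN} {D : set RN}.
Context (mZ : pure_jump_markov P Z) (absZ : absorbed_outside Z D).

Lemma absorbed_stay w (s t : R) : 0 <= s -> s <= t -> D (Z t w) -> D (Z s w).
Proof.
move=> s0 st Dt; apply: contrapT => nD.
by apply: (nD); rewrite -(absZ s0 st nD).
Qed.

(** The inequality is strict because a path in [D] at time [t] was there up to [t]
    by absorption and stays there for a while after [t] by right constancy. *)
Lemma lt_exit_time w (t : R) : 0 <= t ->
  (t%:E < exit_time Z D w)%E <-> D (Z t w).
Proof.
move=> t0; split=> [|Dt].
  apply: contraPP => nD; apply/negP; rewrite -leNgt.
  by apply: ereal_inf_lbound; exists t.
have [r r0 Zr] := near_right (path_right mZ w t0).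
apply: (@lt_le_trans _ _ (t + r)%:E); first by rewrite lte_fin ltrDl.
apply: le_ereal_inf_tmp => _ [s [s0 nDs] <-]; rewrite lee_fin leNgt.
apply/negP => sr; apply: nDs.
have [st|ts] := leP s t; first exact: absorbed_stay Dt.
by rewrite Zr ?ts.
Qed.

Lemma exit_time_lty w :
  (exit_time Z D w < +oo)%E <-> exists k : nat, ~ D (Z k%:R w).
Proof.
split=> [/ereal_inf_lt[_ [t [t0 nDt] <-] _]|[k nDk]].
  exists (Num.truncn t).+1 => Dk; apply: nDt; apply: absorbed_stay Dk => //.
  exact/ltW/truncnS_gt.
apply: (@le_lt_trans _ _ k%:R%:E); last exact: ltry.
by apply: ereal_inf_lbound; exists k%:R.
Qed.

End exit_times.

(** * Exit with a positive rate *)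

Section killed_process.
Context {R : realType} {N : nat} {d : measure_display} {W : measurableType d}.
Notation RN := 'rV[R]_N.
Context {P : RN -> probability W R} {Z : R -> W -> RN} {L : (RN -> R) -> RN -> R}.
Context (mZ : pure_jump_markov P Z) (genL : has_generator P Z L).
Context {D : set RN} (mD : measurable D) (absZ : absorbed_outside Z D).
Context {q0 : R} (q0_gt0 : 0 < q0).
Context (killing : forall x, L \1_D x <= - (q0 * \1_D x)).
Implicit Types (g h : RN -> R) (s t : R) (x : RN).
Local Notation S := (semigroup_of P Z).

Lemma bounded_measurable_indic : bounded_measurable (\1_D : RN -> R).
Proof.
split; first exact: measurable_indic.
by exists 1 => x; rewrite indicE; case: (_ \in _); rewrite ?normr1// normr0.
Qed.
Let b1 := bounded_measurable_indic.

Lemma survival_probability t x : 0 <= t ->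
  P x (Z t @^-1` D) = (S t \1_D x)%:E.
Proof.
move=> t0.
have mZD : measurable (Z t @^-1` D).
  by rewrite -[X in measurable X]setTI; exact: (process_measurable mZ).
rewrite /semigroup_of /Rintegral -[RHS]/(fine (\int[P x]_w (\1_(Z t @^-1` D) w)%:E)%E)%:E.
by rewrite integral_indic// setIT fineK// fin_num_measure.
Qed.

(** By the mean value theorem the survival probability [phi] decreases between 0
    and [T] by [- T] times its derivative at some [c], hence by at least
    [q0 * T * phi c], and absorption gives [phi c >= phi T]. The
    rate [1 / T], slower than the actual exponential one, suffices for the
    limits below. *)
Lemma survival_decay x (T : R) : 0 < T -> S T \1_D x <= (1 + q0 * T)^-1.
Proof.
move=> T0.
have S01 : S 0 \1_D x <= 1.
  by rewrite (semigroup0 mZ)// indicE; case: (_ \in _).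
have pT : {within `[0, T], continuous (fun t => S (Num.max t 0) \1_D x)}.
  by apply: continuous_subspaceT; exact: (continuous_semigroup mZ genL).
have dp t : t \in `]0, T[ ->
    is_derive t 1 (fun t => S (Num.max t 0) \1_D x) (S t (L \1_D) x).
  by rewrite in_itv/= => /andP[t0 _]; exact: (is_derive_semigroup mZ genL).
have [c] := MVT T0 dp pT; rewrite in_itv/= => /andP[c0 cT].
rewrite maxxx (max_l (ltW T0)) subr0 => Sc.
have ST : S T \1_D x <= S c \1_D x.
  apply: le_Rintegral => //.
  - by apply: (integrable_process mZ x _ b1); exact: ltW.
  - by apply: (integrable_process mZ x _ b1); exact: ltW.
  move=> w _; rewrite !indicE; have [/[!inE] DT|_] := boolP (Z T w \in D).
    by rewrite mem_set//; apply: (absorbed_stay absZ _ (ltW cT) DT); exact: ltW.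
  by case: (_ \in _).
have SL : S c (L \1_D) x <= - (q0 * S c \1_D x).
  rewrite -mulNr -(semigroupZ mZ)//; last exact: ltW.
  apply: (le_semigroup mZ); [exact: ltW|exact: (bounded_measurable_generator mZ genL)|
    exact: bounded_measurableZ|by move=> y; rewrite mulNr].
have q1 : 0 < 1 + q0 * T by rewrite ltr_pwDl// mulr_ge0// ltW.
rewrite -[leRHS]mul1r ler_pdivlMr//.
have : S c (L \1_D) x * T <= - (q0 * S c \1_D x) * T by rewrite ler_pM2r.
have : q0 * T * S T \1_D x <= q0 * T * S c \1_D x.
  by rewrite ler_pM2l// mulr_gt0.
lra.
Qed.

Lemma cvg_killed_semigroup g x (M : R) : bounded_measurable g ->
  (forall y, `|g y| <= M * \1_D y) -> S t g x @[t --> +oo] --> 0.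
Proof.
move=> bg gM; apply/cvgrPdist_le => e e0; near=> t.
have t0 : 0 < t by near: t; exact: nbhs_pinfty_gt.
have t0' := ltW t0.
have bM : bounded_measurable (fun y => M * \1_D y) by exact: bounded_measurableZ.
rewrite sub0r normrN (@le_trans _ _ (M * S t \1_D x))//.
  rewrite -(semigroupZ mZ)// ler_norml; apply/andP; split.
    rewrite -mulN1r -(semigroupZ mZ)//.
    apply: (le_semigroup mZ) => //; first exact: bounded_measurableZ.
    by move=> y; rewrite mulN1r; have := gM y; rewrite ler_norml => /andP[].
  apply: (le_semigroup mZ) => // y.
  by have := gM y; rewrite ler_norml => /andP[].
have M0 : 0 <= `|M| by [].
have S0 : 0 <= S t \1_D x by apply: Rintegral_ge0 => w _; rewrite indicE.
have Me : `|M| / e <= q0 * t.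
  by rewrite (mulrC q0) -ler_pdivrMr//; near: t; apply: nbhs_pinfty_ge; exact: num_real.
have q1 : 0 < 1 + q0 * t by rewrite ltr_pwDl// mulr_ge0// ltW.
apply: (@le_trans _ _ (`|M| * (1 + q0 * t)^-1)).
  by rewrite (le_trans (ler_norm _))// normrM (ger0_norm S0) ler_wpM2l// survival_decay.
rewrite ler_pdivrMr//; move: Me; rewrite ler_pdivrMr// => Me.
by rewrite mulrDr mulr1 (le_trans Me)// mulrC lerDr ltW.
Unshelve. all: by end_near. Qed.

Lemma exit_time_finite x :
  P x [set w | (exit_time Z D w < +oo)%E] = 1%E.
Proof.
have mDZ k : measurable (Z k%:R @^-1` D).
  by rewrite -[X in measurable X]setTI; exact: (process_measurable mZ).
have E : [set w | (exit_time Z D w < +oo)%E] = \bigcup_k ~` (Z k%:R @^-1` D).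
  apply/seteqP; split => w /=; first by move/(exit_time_lty absZ) => [k]; exists k.
  by move=> [k _ nD]; apply/(exit_time_lty absZ); exists k.
have mE : measurable [set w | (exit_time Z D w < +oo)%E].
  by rewrite E; apply: bigcupT_measurable => k; exact: measurableC.
apply/eqP; rewrite eq_le probability_le1//=; apply/lee_addgt0Pr => e e0.
pose k := (Num.truncn (e^-1 / q0)).+1.
have k0 : 0 < k%:R :> R by [].
have PE : (1 - (S k%:R \1_D x)%:E <= P x [set w | (exit_time Z D w < +oo)%E])%E.
  rewrite -survival_probability// -probability_setC//; apply: le_measure; rewrite ?inE//.
    exact: measurableC.
  by rewrite E => w nD; exists k.
rewrite -leeBlDr//; apply: le_trans PE; rewrite -!EFinB lee_fin lerB//.
rewrite (le_trans (survival_decay _ k0))// -[leRHS]invrK lef_pV2 ?posrE ?invr_gt0//.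
  have : e^-1 / q0 < k%:R by exact: truncnS_gt.
  by rewrite ltr_pdivrMr// mulrC => h; lra.
by rewrite ltr_pwDl// mulr_ge0// ltW.
Qed.

Lemma measurable_semigroup_time h x : bounded_measurable h ->
  measurable_fun `[0 : R, +oo[ (fun t : R => S t h x).
Proof.
move=> bh.
apply: (eq_measurable_fun (fun t : R => S (Num.max t 0) h x)).
  by move=> t; rewrite inE/= in_itv/= andbT => t0; rewrite max_l.
apply: measurable_funTS; apply: continuous_measurable_fun.
exact: (continuous_semigroup mZ genL).
Qed.

(* The path functional on the product of the sample space with the whole time
   axis, where Fubini's theorem applies. *)
Let path h (p : W * measurableTypeR R) :=
  (h (Z (Num.max p.2 0) p.1) * \1_`[0, +oo[ p.2)%:E.

Let measurable_path_itv h : bounded_measurable h -> measurable_fun setT (path h).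
Proof.
move=> [mh _]; apply/measurable_EFinP; apply: measurable_funM.
  exact: measurable_path mZ _ mh.
apply: measurableT_comp; last exact: measurable_snd.
by apply: measurable_indic; exact: measurable_itv.
Qed.

Let integral_path_fst h x : bounded_measurable h ->
  (\int[@lebesgue_measure R]_t \int[P x]_w path h (w, t) =
   \int[@lebesgue_measure R]_(t in `[0%R, +oo[) (S t h x)%:E)%E.
Proof.
move=> bh; rewrite [RHS]integral_mkcond; apply: eq_integral => t _.
rewrite patchE /path/= indicE; case: ifPn => [|_]; last first.
  by under eq_integral do rewrite mulr0; rewrite integral0.
rewrite inE/= in_itv/= andbT => t0; rewrite max_l//.
under eq_integral do rewrite mulr1.
rewrite /semigroup_of /Rintegral fineK//.
by apply: integrable_fin_num => //; exact: (integrable_process mZ).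
Qed.

Let integral_path_snd h w :
  (\int[@lebesgue_measure R]_t path h (w, t) =
   \int[@lebesgue_measure R]_(t in `[0%R, +oo[) (h (Z t w))%:E)%E.
Proof.
rewrite [RHS]integral_mkcond; apply: eq_integral => t _.
rewrite patchE /path/= indicE; case: ifPn => [|_]; last by rewrite mulr0.
by rewrite inE/= in_itv/= andbT => t0; rewrite max_l// mulr1.
Qed.

(** The occupation identity. The bound on [L g] by a multiple of [\1_D], hence of
    [q = - L \1_D], provides the integrability for Fubini's theorem: the expected
    time integral of [q] equals 1 when the process starts in [D]. *)
Lemma expectation_occupation g x (M M' : R) : bounded_measurable g ->
  (forall y, `|g y| <= M' * \1_D y) -> (forall y, `|L g y| <= M * \1_D y) ->
  ('E_(P x)[fun w => (\int[@lebesgue_measure R]_(t in `[0, +oo[) (L g (Z t w)))%R]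
   = (- g x)%:E)%E.
Proof.
move=> bg gM' LgM; have bLg := bounded_measurable_generator mZ genL bg.
have bL1 := bounded_measurable_generator mZ genL b1.
pose q y := -1 * L \1_D y.
have bq : bounded_measurable q by exact: bounded_measurableZ.
(* Chosen so that [C * q >= |L g|], using [q >= q0 * \1_D]. *)
pose C := `|M| / q0.
have C0 : 0 <= C by rewrite divr_ge0// ltW.
have qL : L (fun y => -1 * \1_D y) = q by rewrite (generatorZ mZ genL).
have q_ge y : q0 * \1_D y <= q y by rewrite /q mulN1r lerNr.
have i01 y : 0 <= (\1_D y : R) by rewrite indicE.
have q_ge0 y : 0 <= q y by rewrite (le_trans _ (q_ge y))// mulr_ge0// ltW.
have LgC y : `|L g y| <= C * q y.
  rewrite (le_trans (LgM y))// (@le_trans _ _ (C * (q0 * \1_D y)))//.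
    by rewrite mulrA divfK ?gt_eqF// ler_wpM2r// ler_norm.
  by rewrite ler_wpM2l.
have b1' : bounded_measurable (fun y => -1 * \1_D y : R).
  exact: bounded_measurableZ.
pose v y := g y + C * (-1 * \1_D y).
have bv : bounded_measurable v.
  by apply: bounded_measurableD => //; exact: bounded_measurableZ.
have Lv : L v = (fun y => L g y + C * q y).
  rewrite (generatorD mZ genL)//; last exact: bounded_measurableZ.
  by rewrite (generatorZ mZ genL)// qL.
have Lv_ge0 y : 0 <= L v y.
  by rewrite Lv; have := LgC y; rewrite ler_norml => /andP[+ _]; lra.
have Iq : (\int[@lebesgue_measure R]_(t in `[0%R, +oo[) (S t q x)%:E =
    (\1_D x)%:E)%E.
  rewrite -qL (ge0_integral_generator mZ genL)//.
  - by rewrite mulN1r opprK.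
  - by rewrite qL.
  - apply: (@cvg_killed_semigroup _ _ 1) => // y.
    by rewrite mul1r mulN1r normrN ger0_norm.
have Iv : (\int[@lebesgue_measure R]_(t in `[0%R, +oo[) (S t (L v) x)%:E =
    (- v x)%:E)%E.
  apply: (ge0_integral_generator mZ genL) => //.
  apply: (@cvg_killed_semigroup _ _ (M' + C)) => // y.
  rewrite mulrDl (le_trans (ler_normD _ _))// lerD// normrM (ger0_norm C0).
  by rewrite mulN1r normrN ger0_norm.
have integrable_time h (c : R) : bounded_measurable h -> (forall y, 0 <= h y) ->
    (\int[@lebesgue_measure R]_(t in `[0%R, +oo[) (S t h x)%:E = c%:E)%E ->
    (@lebesgue_measure R).-integrable `[0, +oo[ (fun t => (S t h x)%:E).
  move=> bh h0 Ih; apply/integrableP; split.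
    by apply/measurable_EFinP; exact: measurable_semigroup_time.
  rewrite [ltLHS](_ : _ = c%:E) ?ltry// -Ih; apply: eq_integral.
  by move=> t _; rewrite gee0_abs// lee_fin; exact: Rintegral_ge0.
have iLg : ((P x) \x (@lebesgue_measure R))%E.-integrable setT (path (L g)).
  have bCq : bounded_measurable (fun y => C * q y) by exact: bounded_measurableZ.
  apply: (@le_integrable _ _ _ _ _ _ _ (path (fun y => C * q y))) => //.
  - exact: measurable_path_itv.
  - move=> p _; rewrite /path lee_fin normrM [leRHS]normrM ler_wpM2r//.
    exact: le_trans (LgC _) (ler_norm _).
  - apply/integrable21ltyP; first exact: measurable_path_itv.
    rewrite [ltLHS](_ : _ = (C * \1_D x)%:E) ?ltry//.
    rewrite EFinM -Iq -integralZl//; last exact: integrable_time Iq.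
    transitivity (\int[@lebesgue_measure R]_(t in `[0%R, +oo[)
        (S t (fun y => (C * q y)%R) x)%:E)%E.
      rewrite -(integral_path_fst x bCq); apply: eq_integral => t _.
      apply: eq_integral => w _; rewrite gee0_abs// lee_fin.
      by apply: mulr_ge0; [exact: mulr_ge0|rewrite indicE].
    apply: eq_integral => t; rewrite inE/= in_itv/= andbT => t0.
    by rewrite (semigroupZ mZ).
rewrite expectation.unlock.
transitivity (\int[P x]_w \int[@lebesgue_measure R]_t path (L g) (w, t))%E.
  pose F := fubini_F (@lebesgue_measure R) (path (L g)).
  have FE w : F w = (\int[@lebesgue_measure R]_(t in `[0%R, +oo[) (L g (Z t w))%:E)%E.
    exact: integral_path_snd.
  have mF : measurable_fun setT F by exact: measurable_fubini_F iLg.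
  apply: ae_eq_integral => //.
    apply/measurable_EFinP; rewrite /Rintegral.
    under eq_fun do rewrite -FE.
    exact: measurableT_comp.
  have /(integrable_ae measurableT) := integrable_fubini_F iLg.
  apply: filterS => w /(_ I) fin _; rewrite /Rintegral -FE fineK//.
rewrite Fubini// integral_path_fst//.
transitivity (\int[@lebesgue_measure R]_(t in `[0%R, +oo[)
    ((S t (L v) x)%:E - C%:E * (S t q x)%:E))%E.
  apply: eq_integral => t; rewrite inE/= in_itv/= andbT => t0.
  rewrite Lv (semigroupD mZ)//; last exact: bounded_measurableZ.
  by rewrite (semigroupZ mZ)// -EFinD addrK.
have bLv : bounded_measurable (L v) by exact: (bounded_measurable_generator mZ genL).
have iq := integrable_time _ _ bq q_ge0 Iq.
rewrite integralB//; last 2 first.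
  exact: integrable_time Iv.
  exact: integrableZl.
rewrite Iv integralZl// Iq -EFinM -EFinB; congr EFin.
by rewrite /v; ring.
Qed.

End killed_process.

(** * Integrals against a jump density *)

Section densities.
Context {R : realType} {N : nat}.
Notation RN := 'rV[R]_N.
Notation leb := (@lebesgue_rV R N).

Definition density (V : RN -> R) :=
  [/\ measurable_fun setT V, forall y, 0 <= V y & (\int[leb]_y (V y)%:E = 1)%E].

Lemma integrable_density V : density V -> leb.-integrable setT (EFin \o V).
Proof.
move=> [mV V0 V1]; apply/integrableP; split; first exact/measurable_EFinP.
rewrite (eq_integral (EFin \o V)); first by rewrite V1 ltry.
by move=> y _; rewrite gee0_abs// lee_fin.
Qed.

Lemma continuous_measurable_rV (V : RN -> R) :
  continuous V -> measurable_fun setT V.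
Proof.
move=> cV; apply: (measurability _ (RGenOpens.measurableE R)).
move=> _ [_ [a [b ->] <-]]; rewrite setTI; apply: sub_sigma_algebra.
by apply: open_comp => [y _|]; [exact: cV|exact: interval_open].
Qed.

Lemma kernel_density (V : RN -> RN -> R) x : admissible_kernel V -> density (V x).
Proof.
move=> [cV V0 _ _ V1]; split => //; apply: continuous_measurable_rV => y.
apply: (@continuous_comp _ _ _ (fun y => (x, y)) (fun p => V p.1 p.2)); last exact: cV.
exact: (cvg_pair (cvg_cst x) (@cvg_id _ (nbhs y))).
Qed.

Lemma kernel_bounded_on_compact (V : RN -> RN -> R) (D : set RN) :
  admissible_kernel V -> compact D ->
  exists2 C, 0 <= C & forall x y, D x -> D y -> V x y <= C.
Proof.
move=> [cV V0 _ _ _] cD.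
have cDD : compact (D `*` D) by exact: compact_setX.
have cV' : {within D `*` D, continuous (fun p : RN * RN => V p.1 p.2)}.
  exact: continuous_subspaceT.
have /compact_bounded[C [Cr HC]] := continuous_compact cV' cDD.
exists (`|C| + 1); first by rewrite addr_ge0.
move=> x y Dx Dy; rewrite (le_trans (ler_norm _))//; apply: HC.
  by rewrite (le_lt_trans (ler_norm C))// ltrDl.
by exists (x, y).
Qed.

Lemma Rintegral_indic_mul (E : set RN) (h : RN -> R) :
  \int[leb]_(y in E) h y = \int[leb]_y (\1_E y * h y).
Proof.
rewrite Rintegral_mkcond; apply: eq_Rintegral => y _.
by rewrite patchE indicE; case: ifPn => _; rewrite ?mul1r ?mul0r.
Qed.

Lemma integrable_indic_density (E : set RN) V : measurable E -> density V ->
  leb.-integrable setT (fun y => (\1_E y * V y)%:E).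
Proof.
move=> mE dV; apply: le_integrable (integrable_density dV) => //.
  apply/measurable_EFinP; apply: measurable_funM; first exact: measurable_indic.
  by case: dV.
move=> y _ /=; rewrite lee_fin normrM indicE.
by case: (_ \in _); rewrite ?normr1 ?normr0 ?mul1r ?mul0r.
Qed.

Lemma integrable_scale (c : R) (h : RN -> R) :
  leb.-integrable setT (fun y => (h y)%:E) ->
  leb.-integrable setT (fun y => (c * h y)%:E).
Proof.
move=> ih; have -> : (fun y => (c * h y)%:E) = (fun y => c%:E * (h y)%:E)%E by [].
exact: integrableZl.
Qed.

(** The function [u] is square integrable, but neither bounded nor a priori
    integrable against [V]. The inequality [V |u| <= V + V u^2 <= V + C u^2] on
    [D] gives integrability with a bound uniform in [V], and allows the
    difference [u y - c] to be split. *)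
Lemma density_weighted_difference V (D E : set RN) (u : RN -> R) (C c : R) :
  density V -> measurable D -> measurable E ->
  0 <= C -> (forall y, D y -> V y <= C) ->
  measurable_fun setT u -> (forall y, ~ D y -> u y = 0) ->
  leb.-integrable setT (fun y => (u y ^+ 2)%:E) ->
  exists a, exists2 m,
    \int[leb]_(y in E) (V y * (u y - c)) = a - c * m &
    `|a| <= 1 + C * \int[leb]_y (u y ^+ 2) /\ \int[leb]_(y in ~` D) (\1_E y * V y) <= m.
Proof.
move=> dV mD mE C0 VC mu u0 u2; have [mV V0 V1] := dV.
have iV := integrable_density dV.
have iEV := integrable_indic_density mE dV.
have iVu2 : leb.-integrable setT (fun y => (V y + C * u y ^+ 2)%:E).
  have -> : (fun y => (V y + C * u y ^+ 2)%:E) =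
    ((EFin \o V) \+ (fun y => (C * u y ^+ 2)%:E))%E by [].
  by apply: integrableD => //; exact: integrable_scale.
have Vu_le y : `|\1_E y * (V y * u y)| <= V y + C * u y ^+ 2.
  have Vu : `|V y * u y| <= V y + C * u y ^+ 2.
    have [Dy|nDy] := pselect (D y); last first.
      by rewrite u0// mulr0 normr0 expr0n mulr0 addr0.
    rewrite normrM ger0_norm//.
    have := VC _ Dy; have := V0 y; have := real_normK (num_real (u y)).
    have := normr_ge0 (u y); have : 0 <= (`|u y| - 1) ^+ 2 by exact: sqr_ge0.
    move=> h1 h2 <- h3 h4; nra.
  rewrite normrM (le_trans _ Vu)// -[leRHS]mul1r ler_wpM2r// indicE.
  by case: (_ \in _); rewrite ?normr1 ?normr0.
have iEVu : leb.-integrable setT (fun y => (\1_E y * (V y * u y))%:E).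
  apply: le_integrable iVu2 => //.
    apply/measurable_EFinP; apply: measurable_funM; first exact: measurable_indic.
    exact: measurable_funM.
  move=> y _; rewrite lee_fin (le_trans (Vu_le y))//; exact: ler_norm.
exists (\int[leb]_y (\1_E y * (V y * u y))), (\int[leb]_y (\1_E y * V y)).
  rewrite Rintegral_indic_mul -RintegralZl// -RintegralB//; last exact: integrable_scale.
  by apply: eq_Rintegral => y _; ring.
split.
  apply: le_trans (le_normr_Rintegral _ iEVu) _ => //.
  have -> : 1 + C * \int[leb]_y (u y ^+ 2) = \int[leb]_y (V y + C * u y ^+ 2).
    rewrite RintegralD//; last exact: integrable_scale.
    by rewrite RintegralZl//; congr (_ + _); rewrite /Rintegral V1.
  by apply: le_Rintegral => //; exact: integrable_norm.
rewrite Rintegral_indic_mul; apply: le_Rintegral => //.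
  have := integrable_indic_density (measurableI _ _ (measurableC mD) mE) dV.
  by under eq_fun do rewrite indicI -mulrA.
move=> y _; rewrite -[leRHS]mul1r ler_wpM2r// ?mulr_ge0// indicE.
Qed.

End densities.

(** * The nonlocal operator *)

Section nonlocal_operator.
Context {R : realType} {N : nat}.
Notation RN := 'rV[R]_N.
Notation leb := (@lebesgue_rV R N).

(** Selecting the kernels by the position of [x] turns the four-term formulas of
    the operator, of the escape rate and of the equation into two-term ones. *)
Definition rate_to_A (A : set RN) (J K : RN -> RN -> R) (x : RN) : RN -> R :=
  if x \in A then J x else K x.
Definition rate_to_B (A : set RN) (K G : RN -> RN -> R) (x : RN) : RN -> R :=
  if x \in A then K x else G x.

Context {D A B : set RN} {J G K : RN -> RN -> R}.
Context (partAB : measurable_partition A B).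
Context (kerJ : admissible_kernel J) (kerG : admissible_kernel G)
  (kerK : admissible_kernel K).
Local Notation VA := (rate_to_A A J K).
Local Notation VB := (rate_to_B A K G).

Lemma in_partition x : (x \in B) = (x \notin A).
Proof.
have [_ _ AB AB0] := partAB; apply/idP/idP => [/set_mem Bx|/negP nA].
  by apply/negP => /set_mem Ax; have : (A `&` B) x by []; rewrite AB0.
have : (A `|` B) x by rewrite AB.
by case=> [/mem_set//|/mem_set].
Qed.

Lemma indic_partition x : (\1_B x : R) = 1 - \1_A x.
Proof. by rewrite !indicE in_partition; case: (_ \in A); rewrite ?subrr ?subr0. Qed.

Lemma density_rate_to_A x : density (VA x).
Proof. by rewrite /rate_to_A; case: ifP => _; exact: kernel_density. Qed.

Lemma density_rate_to_B x : density (VB x).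
Proof. by rewrite /rate_to_B; case: ifP => _; exact: kernel_density. Qed.

Lemma jump_generatorE g x : jump_generator D A B J G K g x = \1_D x *
  (\int[leb]_y (\1_A y * VA x y * (g y - g x)) +
   \int[leb]_y (\1_B y * VB x y * (g y - g x))).
Proof.
rewrite /jump_generator /rate_to_A /rate_to_B !indicI /= indic_partition.
rewrite ![\1_A x]indicE; case: (x \in A); rewrite ?mul1r ?mul0r ?subrr ?subr0; ring.
Qed.

Lemma escape_rateE x : escape_rate D A B J G K x = \1_D x *
  (\int[leb]_(y in ~` D) (\1_A y * VA x y) +
   \int[leb]_(y in ~` D) (\1_B y * VB x y)).
Proof.
rewrite /escape_rate /rate_to_A /rate_to_B !indicI /= indic_partition.
rewrite ![\1_A x]indicE; case: (x \in A); rewrite ?mul1r ?mul0r ?subrr ?subr0; ring.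
Qed.

Lemma dirichlet_solutionE f u x : dirichlet_solution D A B J G K f u -> D x ->
  f x = \int[leb]_(y in A) (VA x y * (u y - u x)) +
        \int[leb]_(y in B) (VB x y * (u y - u x)).
Proof.
move=> [_ _ _ /(_ x)] H /H ->; rewrite /rate_to_A /rate_to_B indic_partition.
rewrite ![\1_A x]indicE; case: (x \in A); rewrite ?mul1r ?mul0r ?subrr ?subr0; ring.
Qed.

Lemma generator_dirichlet_solution f u x :
  dirichlet_solution D A B J G K f u ->
  jump_generator D A B J G K u x = \1_D x * f x.
Proof.
move=> solu; rewrite jump_generatorE indicE.
case: (boolP (x \in D)) => [/set_mem Dx|_]; last by rewrite !mul0r.
rewrite !mul1r (dirichlet_solutionE solu Dx).
rewrite (Rintegral_indic_mul A) (Rintegral_indic_mul B).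
by congr (_ + _); apply: eq_Rintegral => y _; rewrite mulrA.
Qed.

Lemma escape_term (E : set RN) V x : measurable D -> measurable E -> density V ->
  D x -> \int[leb]_y (\1_E y * V y * (\1_D y - \1_D x)) =
    - \int[leb]_(y in ~` D) (\1_E y * V y).
Proof.
move=> mD mE dV Dx; rewrite (Rintegral_indic_mul (~` D)) -[RHS]mulN1r -RintegralZl//.
  apply: eq_Rintegral => y _; rewrite !indicE (mem_set Dx) in_setC.
  by case: (y \in D) => /=; ring.
have := integrable_indic_density (measurableI _ _ (measurableC mD) mE) dV.
by under eq_fun do rewrite indicI -mulrA.
Qed.

(** For [x] in [D] the difference [\1_D y - \1_D x] is [- 1] off [D] and 0 on [D]:
    only the jumps out of [D] contribute. *)
Lemma generator_indic x : measurable D ->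
  jump_generator D A B J G K \1_D x = - escape_rate D A B J G K x.
Proof.
move=> mD; have [mA mB _ _] := partAB; rewrite jump_generatorE escape_rateE.
have [Dx|nDx] := pselect (D x).
  rewrite (escape_term mD mA (density_rate_to_A x) Dx).
  by rewrite (escape_term mD mB (density_rate_to_B x) Dx); ring.
by rewrite [\1_D x]indicE memNset// !mul0r oppr0.
Qed.

(** At a point [x] of [D] the equation reads [u x * m = a - f x], where [m] is the
    total jump rate at [x] and [a] the integral of [u] against the two densities.
    Here [a] is bounded independently of [x], and [m >= q0]. *)
Lemma dirichlet_solution_bounded f u (q0 M : R) : compact D -> measurable D ->
  0 < q0 -> (forall x, D x -> q0 <= escape_rate D A B J G K x) ->
  (forall x, D x -> `|f x| <= M) ->
  dirichlet_solution D A B J G K f u ->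
  exists M', forall x, `|u x| <= M' * \1_D x.
Proof.
move=> cD mD q0_gt0 esc fM solu; have [mu u2 u0 _] := solu.
have [mA mB _ _] := partAB.
have [CJ CJ0 HJ] := kernel_bounded_on_compact kerJ cD.
have [CG CG0 HG] := kernel_bounded_on_compact kerG cD.
have [CK CK0 HK] := kernel_bounded_on_compact kerK cD.
pose C := CJ + CG + CK; have C0 : 0 <= C by rewrite /C; lra.
have VAC x y : D x -> D y -> VA x y <= C.
  move=> Dx Dy; rewrite /rate_to_A /C; have := HJ _ _ Dx Dy; have := HK _ _ Dx Dy.
  by case: ifP => _; lra.
have VBC x y : D x -> D y -> VB x y <= C.
  move=> Dx Dy; rewrite /rate_to_B /C; have := HG _ _ Dx Dy; have := HK _ _ Dx Dy.
  by case: ifP => _; lra.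
pose U := 1 + C * \int[leb]_y (u y ^+ 2).
exists ((U + U + M) / q0) => x; rewrite indicE.
case: (boolP (x \in D)) => [/set_mem Dx|/negP nDx]; last first.
  by rewrite mulr0 u0 ?normr0// => /mem_set.
have [a [m aE [aU qm]]] := density_weighted_difference (u x) (density_rate_to_A x)
  mD mA C0 (fun y => @VAC x y Dx) mu u0 u2.
have [a' [m' a'E [a'U qm']]] := density_weighted_difference (u x) (density_rate_to_B x)
  mD mB C0 (fun y => @VBC x y Dx) mu u0 u2.
rewrite mulr1 ler_pdivlMr//.
have := dirichlet_solutionE solu Dx; rewrite aE a'E => fE.
have qmm : q0 <= m + m'.
  have := esc _ Dx; rewrite escape_rateE indicE mem_set// mul1r.
  by move=> /le_trans; apply; exact: lerD.
have mm0 : 0 <= m + m' by rewrite (le_trans (ltW q0_gt0)).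
apply: (@le_trans _ _ (`|u x| * (m + m'))); first by rewrite ler_wpM2l.
rewrite -(ger0_norm mm0) -normrM.
have -> : u x * (m + m') = a + a' + - f x by rewrite fE; ring.
rewrite (le_trans (ler_normD _ _))// lerD ?normrN ?fM//.
by rewrite (le_trans (ler_normD _ _))// lerD.
Qed.

End nonlocal_operator.

(** * The exit time representation *)

Theorem lemma3p2 (R : realType) (N : nat) (N_gt0 : (0 < N)%N)
  (Omega : set 'rV[R]_N) (domOmega : bounded_domain Omega)
  (J G K : 'rV[R]_N -> 'rV[R]_N -> R)
  (kerJ : admissible_kernel J) (kerG : admissible_kernel G)
  (kerK : admissible_kernel K)
  (A B : nat -> set 'rV[R]_N)
  (partAB : forall k, (0 < k)%N -> measurable_partition (A k) (B k))
  (n : nat) (n_gt0 : (0 < n)%N)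
  (d : measure_display) (W : measurableType d)
  (P : 'rV[R]_N -> probability W R) (Z : R -> W -> 'rV[R]_N)
  (markovZ : pure_jump_markov P Z)
  (genZ : has_generator P Z (jump_generator (closure Omega) (A n) (B n) J G K))
  (absZ : absorbed_outside Z (closure Omega))
  (f : 'rV[R]_N -> R) (f_meas : measurable_fun (closure Omega) f)
  (f_bounded : [bounded f x | x in closure Omega])
  (u : 'rV[R]_N -> R)
  (solu : dirichlet_solution (closure Omega) (A n) (B n) J G K f u)
  (escape_gt0 :
    0 < inf (escape_rate (closure Omega) (A n) (B n) J G K @` closure Omega)) :
  (forall x, closure Omega x ->
     P x [set w | (exit_time Z (closure Omega) w < +oo)%E] = 1%E) /\
  (forall x, closure Omega x ->
     (u x)%:E =
     (- 'E_(P x)[fun w =>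
          (\int[lebesgue_measure]_(t in
              [set t : R | (0 <= t)%R /\ (t%:E < exit_time Z (closure Omega) w)%E])
            f (Z t w))%R])%E).
Proof.
set D := closure Omega; set L := jump_generator D (A n) (B n) J G K.
have [_ _ bOmega [x0 Ox0]] := domOmega.
have AB := partAB _ n_gt0.
have closedD : closed D by exact: closed_closure.
have mD : measurable D by exact: closed_measurable_mx.
have compactD : compact D.
  apply: bounded_closed_compact => //.
  have [M [Mr HM]] := bOmega; exists M; split => // M' MM'.
  rewrite /D closureE; apply: smallest_sub => [|x]; last exact: HM.
  apply: (@closed_comp _ _ (fun x : 'rV[R]_N => `|x|) [set y | y <= M']).
    by move=> x _; exact: norm_continuous.
  exact: closed_le.
set q0 := inf _ in escape_gt0.
have q0_le x : D x -> q0 <= escape_rate D (A n) (B n) J G K x.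
  move=> Dx; apply: ge_inf; last by exists x.
  (* A set without a lower bound has infimum 0 by convention. *)
  suff [] : has_inf (escape_rate D (A n) (B n) J G K @` D) by [].
  by apply: contrapT => /inf_out q00; move: escape_gt0; rewrite /q0 q00 ltxx.
have killing x : L \1_D x <= - (q0 * \1_D x).
  rewrite /L (generator_indic AB kerJ kerG kerK)// lerN2.
  have [Dx|nDx] := pselect (D x); first by rewrite indicE mem_set// mulr1 q0_le.
  by rewrite escape_rateE// indicE memNset// mulr0 mul0r.
have [M fM] : exists M : R, forall x, D x -> `|f x| <= M.
  have [M [Mr HM]] := f_bounded; exists (M + 1) => x Dx.
  by apply: HM => //; rewrite ltrDl.
have [M' uM'] := dirichlet_solution_bounded AB kerJ kerG kerK compactD mD
  escape_gt0 q0_le fM solu.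
have LuE y : L u y = \1_D y * f y by exact: generator_dirichlet_solution solu.
have bu : bounded_measurable u.
  split; first by case: solu.
  exists `|M'| => y; rewrite (le_trans (uM' y))// indicE.
  by case: (_ \in _); rewrite ?mulr1 ?mulr0// ler_norm.
have LuM y : `|L u y| <= M * \1_D y.
  rewrite LuE; have [Dy|nDy] := pselect (D y); rewrite indicE.
    by rewrite mem_set// mul1r mulr1 fM.
  by rewrite memNset// mul0r normr0 mulr0.
split=> x Dx; first exact: (exit_time_finite markovZ genZ mD absZ escape_gt0 killing).
have -> : (u x)%:E = (- (- u x)%:E)%E by rewrite -EFinN opprK.
rewrite -(expectation_occupation markovZ genZ mD absZ escape_gt0 killing x bu uM' LuM).
congr (- 'E_(P x)[_])%E; apply/funext => w.
rewrite Rintegral_mkcond [RHS]Rintegral_mkcond; apply: eq_Rintegral => t _.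
rewrite !patchE mem_setE in_itv/= andbT.
have [t0|t0] := leP 0 t; last first.
  by rewrite memNset// => -[]; rewrite leNgt t0.
rewrite [LHS]LuE; have [DZ|nDZ] := pselect (D (Z t w)).
  rewrite indicE !mem_set ?mul1r//; split => //.
  exact/(lt_exit_time markovZ absZ).
rewrite indicE [in LHS]memNset// mul0r memNset// => -[_].
by move=> /(lt_exit_time markovZ absZ w t0).
Qed.
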